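(* Let $n\ge 0$. The set of proper noncrossing trees with $n$ edges is in bijection with the set $\mathcal{S}_n$ of symmetric ternary trees with $n$ internal vertices. In particular, the number $t_n$ of proper noncrossing trees with $n$ edges equals the number $s_n=|\mathcal{S}_n|$.
   Context: A noncrossing tree with $n$ edges is a tree on the vertex set $\{1,\dots,n+1\}$, the vertices placed in counterclockwise order on a circle, with edges drawn as chords inside the circle that pairwise do not cross. It is rooted at vertex $1$. A descent is an edge $(i,j)$ with $i>j$ such that $i$ is the parent of $j$, i.e. $i$ lies on the path from the root $1$ to $j$. Equivalently, a noncrossing tree is represented as a rooted plane tree in which each non-root vertex $j$ with parent $i$ is labeled $L$ if $i>j$ and $R$ if $i<j$; the root is unlabeled and all children of the root are labeled $R$. In this representation a child labeled $L$ is a ''left child'', a child labeled $R$ is a ''right child'', and descents correspond exactly to $L$-labeled vertices. A noncrossing tree is even if its number of descents is even, odd otherwise. If the tree is even, a non-root vertex $v$ is proper if it has an even number of left children and no right child; if the tree is odd, a non-root vertex $v$ is proper if it has an even number of right children and no left child. A noncrossing tree is proper if every non-root vertex is proper. A ternary tree is either a single node or a root with an ordered triple (left, middle, right) of ternary trees; internal vertices are those with children. A symmetric ternary tree is a ternary tree whose root's middle subtree is a symmetric ternary tree and whose right subtree is the mirror reflection of its left subtree (the single node is symmetric). *)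

(* Defs.v *)
From HB Require Import structures.
From mathcomp Require Import all_boot.

Set Implicit Arguments.
Unset Strict Implicit.
Unset Printing Implicit Defensive.

(* The vertices 1, ..., n+1 are represented by 0, ..., n, i.e. by 'I_n.+1,
   whose order is the cyclic order of the points on the circle; the root is
   ord0. A graph is given by its set of edges. *)

Section NoncrossingTrees.

Variable n : nat.
Notation vertex := 'I_n.+1.
Implicit Types (E : {set {set vertex}}) (u v i j : vertex).

Definition is_graph E := [forall e in E, #|e| == 2].

Definition adj E : rel vertex := [rel u v | (u != v) && ([set u; v] \in E)].

Definition connected E := [forall u, forall v, connect (adj E) u v].

(* A sequence without repetition has at most n.+1 entries, so that bounding
   the length of the cycle loses nothing: see acyclicP. *)
Definition acyclic E :=
  [forall k : 'I_n.+2, forall c : k.-tuple vertex,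
     (2 < k) ==> ~~ ucycleb (adj E) c].

Definition is_tree E := [&& is_graph E, connected E & acyclic E].

(* Two chords cross iff their endpoints are distinct and alternate around the
   circle. *)
Definition noncrossing E :=
  [forall a : vertex, forall b : vertex, forall c : vertex, forall d : vertex,
     [&& a < b, b < c & c < d] ==> ~~ (adj E a c && adj E b d)].

Definition noncrossing_tree E := is_tree E && noncrossing E.

Definition simple_path_to E j (p : seq vertex) :=
  [&& path (adj E) ord0 p, uniq (ord0 :: p) & last ord0 p == j].

(* The length bound on the path is harmless: see on_root_pathP. *)
Definition on_root_path E i j :=
  [exists k : 'I_n.+1, exists p : k.-tuple vertex,
     simple_path_to E j p && (i \in ord0 :: p)].

Definition parent E i j := adj E i j && on_root_path E i j.

Definition descents E :=
  [set ij : vertex * vertex | (ij.2 < ij.1) && parent E ij.1 ij.2].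

Definition left_children E i := [set j | parent E i j && (j < i)].

Definition right_children E i := [set j | parent E i j && (i < j)].

Definition odd_tree E := odd #|descents E|.

Definition proper_vertex E v :=
  if odd_tree E then ~~ odd #|right_children E v| && (left_children E v == set0)
  else ~~ odd #|left_children E v| && (right_children E v == set0).

Definition proper_noncrossing_tree E :=
  noncrossing_tree E && [forall v, (v != ord0) ==> proper_vertex E v].

Lemma acyclicP E :
  reflect (forall c : seq vertex, 2 < size c -> ~ ucycle (adj E) c)
          (acyclic E).
Proof.
apply: (iffP 'forall_'forall_implyP) => acE.
  move=> c c_gt2 cycE; have /andP[_ Uc] := cycE.
  have szc : size c < n.+2.
    by have := max_card (mem c); rewrite (card_uniqP Uc) card_ord.
  by have /negP[] := acE (Ordinal szc) (in_tuple c) c_gt2.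
by move=> k c k_gt2; apply/negP/acE; rewrite size_tuple.
Qed.

Lemma on_root_pathP E i j :
  reflect (exists2 p : seq vertex, simple_path_to E j p & i \in ord0 :: p)
          (on_root_path E i j).
Proof.
apply: (iffP 'exists_'exists_andP) => [[k [p [Ep ip]]]|[p Ep ip]].
  by exists p.
have /and3P[_ Up _] := Ep.
have szp : size p < n.+1.
  by have := max_card (mem (ord0 :: p)); rewrite (card_uniqP Up) card_ord.
by exists (Ordinal szp), (in_tuple p).
Qed.

End NoncrossingTrees.

Definition proper_nct (n : nat) :=
  {E : {set {set 'I_n.+1}} | proper_noncrossing_tree E}.

HB.instance Definition _ n := SubFinite.on (proper_nct n).

Inductive ternary : Type :=
| TLeaf
| TNode of ternary & ternary & ternary.

Fixpoint internal (t : ternary) : nat :=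
  if t is TNode l m r then (internal l + internal m + internal r).+1 else 0.

Fixpoint mirror (t : ternary) : ternary :=
  if t is TNode l m r then TNode (mirror r) (mirror m) (mirror l) else TLeaf.

Fixpoint ternary_code (t : ternary) : GenTree.tree unit :=
  if t is TNode l m r
  then GenTree.Node 1 [:: ternary_code l; ternary_code m; ternary_code r]
  else GenTree.Node 0 [::].

Fixpoint ternary_decode (c : GenTree.tree unit) : ternary :=
  if c is GenTree.Node 1 [:: l; m; r]
  then TNode (ternary_decode l) (ternary_decode m) (ternary_decode r)
  else TLeaf.

Lemma ternary_codeK : cancel ternary_code ternary_decode.
Proof. by elim=> //= l -> m -> r ->. Qed.

HB.instance Definition _ := Countable.copy ternary (can_type ternary_codeK).

Fixpoint symmetric_ternary (t : ternary) : bool :=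
  if t is TNode l m r then symmetric_ternary m && (r == mirror l) else true.

Record sym_ternary (n : nat) := SymTernary {
  sym_ternary_tree :> ternary;
  _ : symmetric_ternary sym_ternary_tree && (internal sym_ternary_tree == n)
}.

HB.instance Definition _ n := [isSub for @sym_ternary_tree n].
HB.instance Definition _ n := [Countable of sym_ternary n by <:].

(* All ternary trees of height at most h, possibly with repetitions. *)
Fixpoint ternary_upto (h : nat) : seq ternary :=
  if h is h'.+1 then
    let s := ternary_upto h' in
    TLeaf :: [seq TNode x.1 x.2.1 x.2.2
             | x <- [seq (l, y) | l <- s, y <- [seq (m, r) | m <- s, r <- s]]]
  else [:: TLeaf].

Lemma mem_ternary_upto h t : internal t <= h -> t \in ternary_upto h.
Proof.
elim: h t => [|h IHh] [|l m r] //=; rewrite ltnS => le_h.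
rewrite inE /=; apply/mapP; exists (l, (m, r)) => //.
apply/allpairsP; exists (l, (m, r)); split=> //=.
  by apply/IHh/(leq_trans _ le_h); rewrite -addnA leq_addr.
apply/allpairsP; exists (m, r); split=> //=; apply/IHh/(leq_trans _ le_h).
  by rewrite addnAC leq_addl.
by rewrite leq_addl.
Qed.

Definition sym_ternary_enum n : seq (sym_ternary n) :=
  undup (pmap insub (ternary_upto n)).

Lemma sym_ternary_enumP n : Finite.axiom (sym_ternary_enum n).
Proof.
apply: Finite.uniq_enumP => [|t]; first exact: undup_uniq.
rewrite mem_undup mem_pmap_sub inE; apply: mem_ternary_upto.
by case/andP: (valP t) => _ /eqP->.
Qed.

HB.instance Definition _ n :=
  isFinite.Build (sym_ternary n) (@sym_ternary_enumP n).

(* Main.v *)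
Require Import Defs.
From mathcomp Require Import all_boot zify.

(* An odd proper tree would have no left child, hence no descent, so every
   proper tree is even: each non-root vertex has only smaller children, an even
   number of them. Read with the root in last place, such a tree is a plane
   tree numbered in postorder, i.e. a parent function [Q] with [i < Q i] and
   [Q j <= Q i] whenever [i < j < Q i]. Deleting the root leaves a forest whose
   vertices all have even degree. If it has an even number of trees, it is empty
   or a shorter such forest followed by two trees, which are given by the even
   forests below their roots: this is the recursion of ternary trees, with two
   vertices per internal vertex. In general it is empty or a forest followed by
   one tree: this is the recursion of symmetric ternary trees, the left subtree
   encoding the last tree and the middle subtree the rest. *)

Set Implicit Arguments.
Unset Strict Implicit.
Unset Printing Implicit Defensive.

(** * Forests with even degrees and ternary trees *)

(* [FSnoc G H] is the forest [G] followed by a tree whose root has [H] as the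
   forest of its subtrees. *)
Inductive forest : Type :=
| FNil
| FSnoc of forest & forest.

Fixpoint fsize F := if F is FSnoc G H then (fsize G + fsize H).+1 else 0.

Fixpoint fdeg F := if F is FSnoc G H then (fdeg G).+1 else 0.

Fixpoint even_forest F :=
  if F is FSnoc G H then [&& even_forest G, even_forest H & ~~ odd (fdeg H)]
  else true.

Fixpoint forest_of_ternary t :=
  if t is TNode l m r
  then FSnoc (FSnoc (forest_of_ternary l) (forest_of_ternary m))
             (forest_of_ternary r)
  else FNil.

(** The right subtree is dropped: symmetry makes it the mirror image of [l]. *)
Fixpoint forest_of_sym t :=
  if t is TNode l m r then FSnoc (forest_of_sym m) (forest_of_ternary l)
  else FNil.

Lemma fsize_forest_of_ternary t :
  fsize (forest_of_ternary t) = (internal t).*2.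
Proof. by elim: t => //= l -> m -> r ->; lia. Qed.

Lemma even_fdeg_forest_of_ternary t : ~~ odd (fdeg (forest_of_ternary t)).
Proof. by elim: t => //= l IHl m _ r _; rewrite negbK. Qed.

Lemma even_forest_of_ternary t : even_forest (forest_of_ternary t).
Proof.
by elim: t => //= l -> m -> r ->; rewrite !even_fdeg_forest_of_ternary.
Qed.

Lemma forest_of_ternary_inj : injective forest_of_ternary.
Proof.
by elim=> [|l IHl m IHm r IHr] [|l' m' r'] //= [/IHl-> /IHm-> /IHr->].
Qed.

(** Trees are peeled off in pairs, a single tree being excluded by parity, so the induction is on
    the size. *)
Lemma forest_of_ternary_surj F :
  even_forest F -> ~~ odd (fdeg F) -> exists t, forest_of_ternary t = F.
Proof.
have [k] := ubnP (fsize F); elim: k F => // k IHk [|[|F G] H] //=.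
  by exists TLeaf.
move=> szF /and3P[/and3P[evF evG dG] evH dH]; rewrite negbK => dF.
have [|||l <-] := IHk F => //; first by lia.
have [|||m <-] := IHk G => //; first by lia.
have [|||r <-] := IHk H => //; first by lia.
by exists (TNode l m r).
Qed.

Lemma internal_mirror t : internal (mirror t) = internal t.
Proof. by elim: t => //= l -> m -> r ->; lia. Qed.

(** The two vertices per internal vertex of [l] account for both [l] and its mirror image. *)
Lemma fsize_forest_of_sym t :
  symmetric_ternary t -> fsize (forest_of_sym t) = internal t.
Proof.
elim: t => //= l _ m IHm r _ /andP[/IHm-> /eqP->].
by rewrite fsize_forest_of_ternary internal_mirror; lia.
Qed.

Lemma even_forest_of_sym t : even_forest (forest_of_sym t).
Proof.
elim: t => //= l _ m -> r _.
by rewrite even_forest_of_ternary even_fdeg_forest_of_ternary.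
Qed.

Lemma forest_of_sym_inj :
  {in symmetric_ternary &, injective forest_of_sym}.
Proof.
elim=> [|l _ m IHm r _] [|l' m' r'] //=; rewrite ?inE /=.
move=> /andP[sm /eqP->] /andP[sm' /eqP->] [eqm /forest_of_ternary_inj->].
by rewrite (IHm m').
Qed.

Lemma forest_of_sym_surj F :
  even_forest F -> exists2 t, symmetric_ternary t & forest_of_sym t = F.
Proof.
elim: F => [|F IHF G _] /=; first by exists TLeaf.
case/and3P=> /IHF[m sm <-] evG dG.
have [l <-] := forest_of_ternary_surj evG dG.
by exists (TNode l m (mirror l)) => //=; rewrite sm eqxx.
Qed.

(** * Postorder parent functions of forests *)

(* The parent of [i] when the vertices of [F] are numbered from [a] in
   postorder and [r] is taken as the parent of the roots of [F]. *)
Fixpoint par F a r i :=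
  if F is FSnoc G H then
    let m := a + fsize G in let v := m + fsize H in
    if i < m then par G a r i else if i < v then par H m v i else r
  else r.

(** These conditions characterise the functions [par F a r] on the interval from [a] to [b.-1]. The
    third one says that the arcs from [i] to [Q i] do not cross. *)
Record nested a b r (Q : nat -> nat) : Prop := Nested {
  nested_gt : forall i, a <= i < b -> i < Q i;
  nested_lt : forall i, a <= i < b -> Q i < b \/ Q i = r;
  nested_le : forall i j, a <= i -> i < j -> j < b -> j < Q i -> Q j <= Q i
}.

Lemma par_nested F a r : a + fsize F <= r ->
  nested a (a + fsize F) r (par F a r).
Proof.
elim: F a r => [|G IHG H IHH] a r /= le_r; first by split; lia.
have [|gtG ltG leG] := IHG a r; first by lia.
have [|gtH ltH leH] := IHH (a + fsize G) (a + fsize G + fsize H); first by lia.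
split=> [i|i|i j].
- move=> hi; case: ifP => hm; first by apply: gtG; lia.
  by case: ifP => hv; [apply: gtH; lia | lia].
- move=> hi; case: ifP => hm; first by have := ltG i; lia.
  by case: ifP => hv; [have := ltH i; lia | lia].
move=> ai ij jb.
case: (ltnP i (a + fsize G)) => im.
  case: (ltnP j (a + fsize G)) => jm; first by apply: leG; lia.
  case: (ltnP j (_ + fsize H)) => jv; last by have := ltG i; lia.
  by have := ltG i; have := ltH j; lia.
rewrite [j < a + fsize G]ltnNge (leq_trans im (ltnW ij)) /=.
case: (ltnP i (_ + fsize H)) => iv; last by lia.
case: (ltnP j (_ + fsize H)) => jv; first by apply: leH; lia.
by have := ltH i; lia.
Qed.

Lemma par_last F a r : 0 < fsize F -> par F a r (a + fsize F).-1 = r.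
Proof.
case: F => //= G H _.
case: ifP => [|_]; first by lia.
by case: ifP => //; lia.
Qed.

(** The function determines where the last tree begins. If [G] were shorter than [G'], the last
    vertex of [G'] would have parent [r] in one forest, while in the other it would lie in [H],
    whose parents are smaller than [r]. *)
Lemma par_inj F F' a r :
    a + fsize F <= r -> fsize F = fsize F' ->
    (forall i, a <= i < a + fsize F -> par F a r i = par F' a r i) ->
  F = F'.
Proof.
elim: F F' a r => [|G IHG H IHH] [|G' H'] a r //= le_r [szF] eqF.
have eqG : fsize G = fsize G'.
  wlog: G H G' H' le_r szF eqF {IHG IHH} / fsize G <= fsize G'.
    move=> IH; case: (leqP (fsize G) (fsize G')) => [|/ltnW] leG.
      exact: (IH G H G' H').
    by apply/esym/(IH G' H' G H) => [||i hi|] //; [lia..|rewrite eqF; lia].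
  rewrite leq_eqVlt => /orP[/eqP//|ltG].
  have := eqF (a + fsize G').-1.
  rewrite ifF; last by lia.
  rewrite ifT; last by lia.
  rewrite ifT; last by lia.
  rewrite par_last; last by lia.
  have [|_ + _] := @par_nested H (a + fsize G) (a + fsize G + fsize H).
    by lia.
  by move=> /(_ (a + fsize G').-1); lia.
have eqH : fsize H = fsize H' by lia.
congr FSnoc.
  apply: (IHG _ a r) => // [|i hi]; first by lia.
  by have := eqF i; rewrite -eqG ifT ?ifT; [apply|..]; lia.
apply: (IHH _ (a + fsize G) (a + fsize G + fsize H)) => // i hi.
have im : (i < a + fsize G) = false by lia.
have iv : i < a + fsize G + fsize H by lia.
by have := eqF i; rewrite -eqG -eqH im iv; apply; lia.
Qed.

Lemma nested_par a b r Q : a <= b -> b <= r -> nested a b r Q ->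
  exists2 F, a + fsize F = b & forall i, a <= i < b -> par F a r i = Q i.
Proof.
have [k] := ubnP (b - a); elim: k a b r Q => // k IHk a b r Q ltk.
rewrite leq_eqVlt => /orP[/eqP<- _ _|].
  by exists FNil => [|i] /=; lia.
case: b ltk => // v ltk; rewrite ltnS => av vr [gtQ ltQ leQ].
(* The last vertex [v] is a root. The cut [m] comes just after the previous root, or is [a] if there
   is none, so the vertices from [m] to [v.-1] lie below [v]. *)
have [m [am mv rm Qm]] : exists m, [/\ a <= m, m <= v,
    forall i, m <= i < v -> Q i <> r & a < m -> Q m.-1 = r].
  elim: (v) av => [|w IHw].
    by rewrite leqn0 => /eqP->; exists 0; split; lia.
  rewrite leq_eqVlt => /orP[/eqP->|aw].
    by exists w.+1; split; lia.
  have [/eqP Qw|Qw] := boolP (Q w == r); first by exists w.+1; split=> //; lia.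
  have [m [am mw rm Qm]] := IHw aw; exists m; split=> //; first by lia.
  move=> i hi; have [->|neq] := eqVneq i w; first exact/eqP.
  by apply: rm; lia.
have [||||G szG parG] := IHk a m r Q; try lia.
  split=> [i hi|i hi|i j ai ij jm]; first by apply: gtQ; lia.
    have [->|neq] := eqVneq i m.-1; first by right; apply: Qm; lia.
    (* An arc from [i] passing over the root [m.-1] must end at [r], by [nested_le]. *)
    by have := gtQ i; have := ltQ i; have := leQ i m.-1; have := Qm; lia.
  by apply: leQ; lia.
(* No value is [r] here, so all are at most [v], which takes over the role of [r]. *)
have [||||H szH parH] := IHk m v v Q; try lia.
  split=> [i hi|i hi|i j ai ij jm]; first by apply: gtQ; lia.
    by have := ltQ i; have := rm i; lia.
  by apply: leQ; lia.
exists (FSnoc G H) => /= [|i hi]; first by lia.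
rewrite szG szH; case: ltnP => im; first by apply: parG; lia.
case: ltnP => iv; first by apply: parH; lia.
by have := ltQ i; have := gtQ i; lia.
Qed.

(** * Counting children *)

Definition nchildren a b (Q : nat -> nat) w := \sum_(a <= i < b) (Q i == w).

Lemma eq_nchildren a b Q Q' w : (forall i, a <= i < b -> Q i = Q' i) ->
  nchildren a b Q w = nchildren a b Q' w.
Proof. by move=> eqQ; apply: eq_big_nat => i /eqQ->. Qed.

Lemma nchildren_eq0 a b Q w : (forall i, a <= i < b -> Q i <> w) ->
  nchildren a b Q w = 0.
Proof.
move=> neqQ; rewrite /nchildren big_nat_cond big1 // => i /andP[/neqQ/eqP].
by move/negPf->.
Qed.

Lemma nchildren_snoc G H a r w :
  let m := a + fsize G in let v := m + fsize H in
  nchildren a v.+1 (par (FSnoc G H) a r) w =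
    nchildren a m (par G a r) w + nchildren m v (par H m v) w + (r == w).
Proof.
move=> m v; rewrite /nchildren big_nat_recr /=; last by rewrite /v /m; lia.
rewrite (@big_cat_nat _ _ _ m) /=; try by rewrite /v /m; lia.
congr (_ + _ + _).
- by apply: eq_big_nat => i /andP[_ im]; rewrite im.
- by apply: eq_big_nat => i /andP[mi iv]; rewrite ltnNge mi iv.
by rewrite ltnn ltnNge leq_addr.
Qed.

Lemma nchildren_par F a r : a + fsize F <= r ->
  nchildren a (a + fsize F) (par F a r) r = fdeg F.
Proof.
elim: F a r => [|G IHG H _] a r le_r; first by rewrite nchildren_eq0 //=; lia.
rewrite /= in le_r; rewrite [fsize _]/= addnS addnA nchildren_snoc eqxx.
rewrite IHG /=; last by lia.
rewrite nchildren_eq0; first by lia.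
have [|_ ltH _ i /ltH] := @par_nested H (a + fsize G) (a + fsize G + fsize H).
  by lia.
by lia.
Qed.

(** Children of a vertex of [G] lie in [G], and those of a vertex of [H] or of [v] lie in [H]. The
    count at [v] is [fdeg H], which gives the last conjunct of [even_forest]. *)
Lemma even_forestP F a r : a + fsize F <= r ->
  even_forest F <->
  forall w, a <= w < a + fsize F ->
    ~~ odd (nchildren a (a + fsize F) (par F a r) w).
Proof.
elim: F a r => [|G IHG H IHH] a r le_r; first by split=> //= _ w; lia.
rewrite /= in le_r; rewrite [fsize _]/= addnS addnA.
set m := a + fsize G; set v := m + fsize H.
have vr : v < r by rewrite /v /m; lia.
have mr : m <= r by rewrite /v in vr; lia.
have [gtG ltG _] := @par_nested G a r mr.
have [gtH ltH _] := @par_nested H m v (leqnn v).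
have nG w : a <= w < m ->
    nchildren a v.+1 (par (FSnoc G H) a r) w = nchildren a m (par G a r) w.
  move=> hw; rewrite nchildren_snoc -/m -/v (@nchildren_eq0 m) ?addn0.
    by have -> : (r == w) = false; lia.
  by move=> i hi; have := gtH i; rewrite -/v; lia.
have nH w : m <= w <= v ->
    nchildren a v.+1 (par (FSnoc G H) a r) w = nchildren m v (par H m v) w.
  move=> hw; rewrite nchildren_snoc -/m -/v (@nchildren_eq0 a) ?add0n.
    by have -> : (r == w) = false; lia.
  by move=> i hi; have := ltG i; rewrite -/m; lia.
have am : a <= m by rewrite leq_addr.
have mv : m <= v by rewrite leq_addr.
rewrite /=; split=> [/and3P[/(IHG a r mr) evG] | ev].
  move=> /(IHH m v (leqnn v)) evH dH w hw.
  have [wm|mw] := ltnP w m; first by rewrite nG ?evG; lia.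
  have [wv|vw] := ltnP w v; first by rewrite nH ?evH; lia.
  have -> : w = v by lia.
  by rewrite nH ?nchildren_par; lia.
apply/and3P; split.
- by apply/(IHG a r mr) => w hw; rewrite -nG ?ev; lia.
- by apply/(IHH m v (leqnn v)) => w hw; rewrite -nH ?ev; rewrite -/v in hw; lia.
by rewrite -(@nchildren_par H m v (leqnn v)) -nH ?ev; lia.
Qed.

(** * From nested parent functions to proper noncrossing trees *)

Section ParentGraph.

Variable n : nat.
Implicit Types (E : {set {set 'I_n.+1}}) (Q : nat -> nat) (u v i j : 'I_n.+1).

(* Moving the root from the first to the last place makes every parent of a
   proper tree larger than its children. *)
Definition rank i : nat := if i == ord0 then n.+1 else i.

(* The label [n.+1] stands for the root: [inord] sends it to [ord0]. *)
Definition up Q j : 'I_n.+1 := inord (Q j).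

Definition parent_graph Q := [set [set j; up Q j] | j : 'I_n.+1 & j != ord0].

Lemma rank_inord k : 0 < k <= n.+1 -> rank (inord k) = k.
Proof.
rewrite /rank => /andP[k_gt0]; rewrite leq_eqVlt => /orP[/eqP->|ltk].
  by rewrite /inord /insubd insubF ?ltnn ?eqxx.
by rewrite -(inj_eq val_inj) /= inordK // eqn0Ngt k_gt0.
Qed.

Lemma rank_gt0 i : 0 < rank i <= n.+1.
Proof.
rewrite /rank; case: eqVneq => [|]; first by rewrite leqnn.
by rewrite -(inj_eq val_inj) /= lt0n => ->; rewrite ltnW.
Qed.

Lemma rankK i : inord (rank i) = i.
Proof.
rewrite /rank; case: eqVneq => [->|_]; last exact: inord_val.
by rewrite /inord /insubd insubF ?ltnn.
Qed.

Lemma rank_inj : injective rank.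
Proof. exact: can_inj rankK. Qed.

Lemma rank_nz i : i != ord0 -> rank i = i.
Proof. by rewrite /rank => /negPf->. Qed.

Lemma rank0 : rank ord0 = n.+1.
Proof. by rewrite /rank eqxx. Qed.

Lemma nz_gt0 i : (i != ord0) = (0 < i).
Proof. by rewrite -(inj_eq val_inj) lt0n. Qed.

Lemma adj_sym E : symmetric (adj E).
Proof. by move=> u v; rewrite /adj /= eq_sym setUC. Qed.

Lemma card_descents E : #|descents E| = \sum_i #|left_children E i|.
Proof.
rewrite -sum1dep_card big_mkcond /=.
rewrite -(pair_bigA _ (fun i j => if (j < i) && parent E i j then 1 else 0)) /=.
apply: eq_bigr => i _; rewrite -sum1dep_card [RHS]big_mkcond.
by apply: eq_bigr => j _; rewrite andbC.
Qed.

Lemma left_children_root E : left_children E ord0 = set0.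
Proof. by apply/setP => j; rewrite !inE ltn0 andbF. Qed.

Section Nested.

Variable Q : nat -> nat.
Hypothesis nQ : nested 1 n.+1 n.+1 Q.
Notation E := (parent_graph Q).

Definition child u j := (j != ord0) && (u == up Q j).

Lemma nested_bounds j : j != ord0 -> j < Q j <= n.+1.
Proof.
rewrite nz_gt0 => j_gt0; have ltj := ltn_ord j.
by have := nested_gt nQ (i := j); have := nested_lt nQ (i := j); lia.
Qed.

Lemma rank_up j : j != ord0 -> rank (up Q j) = Q j.
Proof. by move=> /nested_bounds bQ; apply: rank_inord; lia. Qed.

Lemma child_rank u j : child u j -> rank j < rank u.
Proof.
case/andP=> j0 /eqP->; rewrite rank_up // rank_nz //.
by have := nested_bounds j0; lia.
Qed.

Lemma child_neq u j : child u j -> u != j.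
Proof. by move=> /child_rank; apply: contraTneq => ->; rewrite ltnn. Qed.

Lemma adj_child u v : adj E u v = child u v || child v u.
Proof.
apply/andP/orP => [[neq_uv /imsetP[j]]|].
  rewrite inE => j0 eq_uv.
  have: u \in [set j; up Q j] by rewrite -eq_uv set21.
  have: v \in [set j; up Q j] by rewrite -eq_uv set22.
  case/set2P=> eq_v /set2P[] eq_u; move: neq_uv;
    rewrite eq_u eq_v ?eqxx // => _.
    by left; rewrite /child j0 eqxx.
  by right; rewrite /child j0 eqxx.
case=> c; split.
- exact: child_neq c.
- by apply/imsetP; case/andP: c => v0 /eqP->; exists v; rewrite ?inE // setUC.
- by rewrite eq_sym; apply: child_neq c.
by apply/imsetP; case/andP: c => u0 /eqP->; exists u; rewrite ?inE.
Qed.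

Lemma parent_graph_is_graph : is_graph E.
Proof.
apply/'forall_implyP => e /imsetP[j]; rewrite inE => j0 ->.
by rewrite cards2 [j == _]eq_sym (@child_neq (up Q j) j) // /child j0 eqxx.
Qed.

Lemma child_up j : j != ord0 -> child (up Q j) j.
Proof. by rewrite /child eqxx andbT. Qed.

Lemma child_path_last x p y :
  path child x p -> y \in x :: p -> rank (last x p) <= rank y.
Proof.
elim: p x y => [|z p IHp] x y /=; first by rewrite inE => _ /eqP->.
case/andP=> /child_rank lt_zx cp; rewrite inE => /predU1P[->|]; last exact: IHp.
by apply/ltnW/(leq_ltn_trans _ lt_zx)/IHp; rewrite ?mem_head.
Qed.

Lemma root_path j : exists2 p, simple_path_to E j p & path child ord0 p.
Proof.
have [k] := ubnP (n.+1 - rank j); elim: k j => // k IHk j ltk.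
have [->|j0] := eqVneq j ord0.
  by exists [::]; rewrite /simple_path_to //= eqxx.
have cj := child_up j0; have ltj := child_rank cj.
have [|p /and3P[Ep Up /eqP lastp] cp] := IHk (up Q j).
  by have := rank_gt0 (up Q j); lia.
exists (rcons p j); last by rewrite rcons_path cp lastp.
apply/and3P; split; last by rewrite last_rcons.
  by rewrite rcons_path Ep lastp adj_child cj.
(* Ranks decrease along [p], so none of its vertices ranks below its end [up Q j], whereas [j]
   does. *)
rewrite -rcons_cons rcons_uniq Up andbT; apply/negP => jp.
by have := child_path_last cp jp; rewrite lastp leqNgt ltj.
Qed.

(** A simple path from the root never turns upwards: an upward step would return to the vertex just
    left. The disjunction is the invariant of the induction. *)
Lemma simple_child_path x p :
    path (adj E) x p -> uniq (x :: p) -> x = ord0 \/ up Q x \notin p ->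
  path child x p.
Proof.
elim: p x => //= y p IHp x /andP[Exy Ep] /andP[xp Uyp] hx.
have cxy : child x y.
  move: Exy; rewrite adj_child => /orP[//|/andP[x0 /eqP eqy]].
  by case: hx x0 => [->|]; rewrite ?eqxx // -eqy mem_head.
rewrite cxy IHp //; right; case/andP: cxy => _ /eqP <-.
by move: xp; rewrite inE negb_or => /andP[].
Qed.

Lemma parent_child u j : parent E u j = child u j.
Proof.
apply/andP/idP => [[Euj /on_root_pathP[p /and3P[Ep Up /eqP lastp] up]]|cuj].
  have cp := simple_child_path Ep Up (or_introl erefl).
  (* If [u] were a child of [j], it would rank below [j], yet it precedes [j] on a descending
     path. *)
  move: Euj; rewrite adj_child => /orP[//|/child_rank].
  by rewrite ltnNge -lastp child_path_last.
rewrite adj_child cuj; split=> //; apply/on_root_pathP.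
have [p Epj cp] := root_path j; exists p => //.
have /and3P[_ _ /eqP lastp] := Epj.
case/lastP: p => [|p y] in Epj cp lastp *.
  by case/andP: cuj; rewrite -lastp eqxx.
move: lastp cp; rewrite last_rcons rcons_path => -> /andP[_ /andP[_ /eqP cj]].
case/andP: cuj => _ /eqP ->; rewrite -cj.
by rewrite -rcons_cons mem_rcons inE mem_last orbT.
Qed.

Lemma parent_graph_connected : connected E.
Proof.
have con0 j : connect (adj E) ord0 j.
  have [p /and3P[Ep _ /eqP <-] _] := root_path j.
  by apply/connectP; exists p.
apply/'forall_forallP => u v; apply: connect_trans (con0 v).
by rewrite (sym_connect_sym (adj_sym E)).
Qed.

(* Both neighbours of the vertex of least rank on a cycle are its parent. *)
Lemma parent_graph_acyclic : acyclic E.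
Proof.
apply/acyclicP => c c_gt2 /andP[cE Uc].
have [x0 x0c] : exists x, x \in c.
  by case: c c_gt2 {cE Uc} => // x c; exists x; rewrite mem_head.
have [x xc minx] := arg_minnP rank x0c.
have [i s eq_c] := rot_to xc.
move: cE Uc c_gt2; rewrite -(rot_cycle i) -(rot_uniq i) -(size_rot i) eq_c.
case: s => [|y s] // in eq_c *; case/lastP: s => [|s z] // in eq_c *.
rewrite /= rcons_path last_rcons => /and3P[Exy _ Ezx] Uc _.
have min w : w \in x :: y :: rcons s z -> rank x <= rank w.
  by rewrite -eq_c mem_rot => /minx.
have up_x w : w \in x :: y :: rcons s z -> adj E x w -> w = up Q x.
  move=> /min le_xw; rewrite adj_child => /orP[/child_rank|/andP[_ /eqP//]].
  by rewrite ltnNge le_xw.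
have eqy : y = up Q x by apply: up_x => //; rewrite !inE eqxx orbT.
have eqz : z = up Q x.
  by apply: up_x; rewrite ?[adj E x z]adj_sym // !inE mem_rcons mem_head !orbT.
by move: Uc; rewrite eqz -eqy mem_rcons mem_head andbF.
Qed.

(** Between non-root vertices the larger end of an edge is the parent, so [Q b = d]. If [a] is the
    root, then [Q c = n.+1] contradicts [nested_le] at [b < c < d]; otherwise [Q a = c] contradicts
    it at [a < b < c]. *)
Lemma parent_graph_noncrossing : noncrossing E.
Proof.
apply/'forall_'forall_'forall_'forall_implyP => a b c d /and3P[ab bc cd].
rewrite !adj_child; apply/negP => /andP[Eac Ebd].
have b0 : b != ord0 by rewrite nz_gt0; lia.
have c0 : c != ord0 by rewrite nz_gt0; lia.
have d0 : d != ord0 by rewrite nz_gt0; lia.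
have [rb rc rd] := And3 (rank_nz b0) (rank_nz c0) (rank_nz d0).
have Qb : Q b = d.
  case/orP: Ebd => [/child_rank|/andP[_ /eqP eqd]]; first by lia.
  by rewrite -rd eqd rank_up.
have [a0|a0] := eqVneq a ord0.
  have Qc : Q c = n.+1.
    case/orP: Eac => [/andP[_ /eqP eqa]|/andP[]]; last by rewrite a0 eqxx.
    by rewrite -(rank_up c0) -eqa a0 rank0.
  have := nested_le nQ (i := b) (j := c); have := ltn_ord c.
  by have := ltn_ord d; lia.
have Qa : Q a = c.
  case/orP: Eac => [/child_rank|/andP[_ /eqP eqc]].
    by rewrite rc rank_nz //; lia.
  by rewrite -rc eqc rank_up.
move: a0; rewrite nz_gt0 => a0.
by have := nested_le nQ (i := a) (j := b); have := ltn_ord b; lia.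
Qed.

Lemma card_children v : v != ord0 ->
  #|[set j | child v j]| = nchildren 1 n.+1 Q v.
Proof.
move=> v0; rewrite -sum1dep_card big_mkcond /=.
(* The factor [0 < k] cancels the term of the root, over which [nchildren] does not sum. *)
pose F k : nat := (0 < k) && (Q k == v).
transitivity (\sum_(j < n.+1) F j).
  apply: eq_bigr => j _; rewrite /F /child -nz_gt0.
  have [j0|//] := boolP (j != ord0).
  by rewrite -(inj_eq rank_inj) rank_up // rank_nz // eq_sym; case: eqP.
rewrite -(big_mkord xpredT) big_ltn // add0n.
by apply: eq_big_nat => k /andP[k0 _]; rewrite /F k0.
Qed.

Lemma left_children_child v : v != ord0 ->
  left_children E v = [set j | child v j].
Proof.
move=> v0; apply/setP => j; rewrite !inE parent_child.
case: (boolP (child v j)) => //= cvj; have := child_rank cvj.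
by case/andP: cvj => j0 _; rewrite !rank_nz.
Qed.

Lemma right_children_child v : v != ord0 -> right_children E v = set0.
Proof.
move=> v0; apply/setP => j; rewrite !inE parent_child.
case: (boolP (child v j)) => //= cvj; have := child_rank cvj.
by case/andP: cvj => j0 _; rewrite !rank_nz //; lia.
Qed.

Lemma parent_graph_proper :
    (forall v, v != ord0 -> ~~ odd (nchildren 1 n.+1 Q v)) ->
  proper_noncrossing_tree E.
Proof.
move=> ev.
have evl v : v != ord0 -> ~~ odd #|left_children E v|.
  by move=> v0; rewrite left_children_child // card_children // ev.
(* The descents are counted by a sum of even numbers of left children, the root having none. *)
have evE : ~~ odd_tree E.
  rewrite /odd_tree card_descents; elim/big_ind: _ => //= [x y|v _].
    by rewrite oddD => /negPf-> /negPf->.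
  by have [->|/evl//] := eqVneq v ord0; rewrite left_children_root cards0.
apply/andP; split; last first.
  apply/forallP => v; apply/implyP => v0; rewrite /proper_vertex (negPf evE).
  by rewrite evl // right_children_child ?eqxx.
by rewrite /noncrossing_tree /is_tree parent_graph_is_graph
  parent_graph_connected parent_graph_acyclic parent_graph_noncrossing.
Qed.

End Nested.

(** The relation [parent] depends on the graph only, and the rank of the parent gives back [Q]. *)
Lemma parent_graph_inj Q Q' : nested 1 n.+1 n.+1 Q -> nested 1 n.+1 n.+1 Q' ->
  parent_graph Q = parent_graph Q' -> forall k, 1 <= k < n.+1 -> Q k = Q' k.
Proof.
move=> nQ nQ' eqE k /andP[k0 kn]; pose j := Ordinal kn.
have j0 : j != ord0 by rewrite nz_gt0.
have : parent (parent_graph Q) (up Q j) j by rewrite parent_child // child_up.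
rewrite eqE parent_child // => /andP[_ /eqP/(congr1 rank)].
by rewrite !rank_up.
Qed.

(** * From proper noncrossing trees to nested parent functions *)

Section ProperTree.

Variable E : {set {set 'I_n.+1}}.
Hypothesis pE : proper_noncrossing_tree E.

Let graphE : is_graph E. Proof. by case/andP: pE => /andP[/and3P[]]. Qed.
Let conE : connected E. Proof. by case/andP: pE => /andP[/and3P[]]. Qed.
Let acE : acyclic E. Proof. by case/andP: pE => /andP[/and3P[]]. Qed.
Let ncE : noncrossing E. Proof. by case/andP: pE => /andP[]. Qed.

Lemma simple_path_exists j : exists p, simple_path_to E j p.
Proof.
have /connectP[p Ep ->] : connect (adj E) ord0 j by move/'forall_forallP: conE.
by case/shortenP: Ep => q Eq Uq _; exists q; rewrite /simple_path_to Eq Uq eqxx.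
Qed.

Lemma adj_parent u v : adj E u v -> parent E u v || parent E v u.
Proof.
move=> Euv; rewrite /parent Euv adj_sym Euv /=.
have [p Ep] := simple_path_exists u.
(* Either [v] lies on the path to [u], or this path extends to a simple path to [v] through [u]. *)
have [vp|vp] := boolP (v \in ord0 :: p).
  by apply/orP; right; apply/on_root_pathP; exists p.
apply/orP; left; apply/on_root_pathP; exists (rcons p v).
  case/and3P: Ep => Ep Up /eqP lastp; apply/and3P; split.
  - by rewrite rcons_path Ep lastp.
  - by rewrite -rcons_cons rcons_uniq vp.
  by rewrite last_rcons.
case/and3P: Ep => _ _ /eqP <-.
by rewrite -rcons_cons mem_rcons inE mem_last orbT.
Qed.

Lemma parent_exists j : j != ord0 -> exists i, parent E i j.
Proof.
move=> j0; have [p Ep] := simple_path_exists j.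
case/lastP: p => [|p k] in Ep *.
  by case/and3P: Ep => _ _ /eqP eqj; rewrite -eqj eqxx in j0.
exists (last ord0 p); apply/andP; split; last first.
  apply/on_root_pathP; exists (rcons p k) => //.
  by rewrite -rcons_cons mem_rcons inE mem_last orbT.
case/and3P: Ep; rewrite rcons_path last_rcons => /andP[_ Ek] _ /eqP <-.
exact: Ek.
Qed.

Definition adj_avoid j := [rel x y | [&& adj E x y, x != j & y != j]].

(** A simple path to [j] meets [j] only at its end, so its part up to [i] avoids [j]. *)
Lemma parent_avoid i j : parent E i j -> connect (adj_avoid j) ord0 i.
Proof.
case/andP=> /andP[ij _] /on_root_pathP[p /and3P[Ep Up /eqP lastp] ip].
case/splitPl: ip => p1 p2 lasti in Ep Up lastp *.
apply/connectP; exists p1 => //.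
have jp1 : j \notin ord0 :: p1.
  move: Up; rewrite -cat_cons cat_uniq => /and3P[_ /hasPn nh _]; apply: nh.
  move: lastp; rewrite last_cat lasti; case: p2 {Ep} => [/eqP|y p2 <-] /=.
    by rewrite (negPf ij).
  exact: mem_last.
move: Ep; rewrite cat_path => /andP[Ep1 _].
elim: p1 (ord0) jp1 Ep1 {lasti Up lastp} => //= y p1 IHp x.
rewrite inE negb_or => /andP[jx jp] /andP[-> Ep1]; rewrite eq_sym jx eq_sym.
rewrite IHp // andbT /=.
by move: jp; rewrite inE negb_or => /andP[].
Qed.

(* Two parents of [j] would close a cycle through [j], since both are joined to
   the root without visiting [j]. *)
Lemma parent_uniq i i' j : parent E i j -> parent E i' j -> i = i'.
Proof.
move=> pi pi'; apply/eqP/negPn/negP => neq.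
have sym : symmetric (adj_avoid j).
  by move=> x y; rewrite /= adj_sym [(x != j) && _]andbC.
have : connect (adj_avoid j) i i'.
  apply: connect_trans (parent_avoid pi').
  by rewrite (sym_connect_sym sym) parent_avoid.
case/connectP=> p Ep eqi'; case/shortenP: Ep eqi' => q Eq Uq _ eqi'.
have jq : j \notin i :: q.
  rewrite inE negb_or; apply/andP; split.
    by case/andP: pi => /andP[]; rewrite eq_sym.
  elim: q (i) Eq {Uq eqi'} => //= y q IHq x /andP[/and3P[_ _ yj] /IHq jq].
  by rewrite inE negb_or eq_sym yj.
case: q => [|y q] in Eq Uq eqi' jq *; first by rewrite eqi' eqxx in neq.
have /acyclicP/(_ [:: j, i, y & q] erefl) := acE; apply.
apply/andP; split; last by rewrite cons_uniq jq.
rewrite /cycle rcons_path (_ : last j _ = i') //.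
have [/andP[Eij _] /andP[Ei'j _]] := (pi, pi').
rewrite Ei'j andbT [path _ _ _]/(adj E j i && path (adj E) i (y :: q)).
by rewrite adj_sym Eij; apply: sub_path Eq => u v /and3P[].
Qed.

Lemma proper_even : odd_tree E = false.
Proof.
apply/negP => oddE; have := oddE.
rewrite /odd_tree card_descents big1 // => v _.
have [->|v0] := eqVneq v ord0; first by rewrite left_children_root cards0.
case/andP: pE => _ /forallP/(_ v)/implyP/(_ v0).
by rewrite /proper_vertex oddE => /andP[_ /eqP->]; rewrite cards0.
Qed.

Lemma proper_left v : v != ord0 ->
  ~~ odd #|left_children E v| /\ right_children E v = set0.
Proof.
move=> v0; case/andP: pE => _ /forallP/(_ v)/implyP/(_ v0).
by rewrite /proper_vertex proper_even => /andP[? /eqP].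
Qed.

Lemma parent_rank i j : parent E i j -> rank j < rank i /\ j != ord0.
Proof.
move=> pij.
have [/andP[ij _] /on_root_pathP[p Ep ip]] := andP pij.
have j0 : j != ord0.
  apply: contraNneq ij => j0; rewrite j0 in Ep.
  case/and3P: Ep ip; case: p => [|x p] /=; first by rewrite inE j0.
  by move=> _ /andP[+ _] /eqP eq0; rewrite -{1}eq0 mem_last.
split=> //; rewrite [rank j]rank_nz //.
have [->|i0] := eqVneq i ord0; first by rewrite rank0 ltn_ord.
rewrite rank_nz // ltn_neqAle (inj_eq val_inj) eq_sym ij leqNgt /=.
(* If [i < j], then [j] would be a right child of [i]. *)
have [_ /setP/(_ j)] := proper_left i0.
by rewrite !inE pij /= => ->.
Qed.

Lemma proper_parent_graph : exists2 Q, nested 1 n.+1 n.+1 Q &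
  E = parent_graph Q.
Proof.
(* The default [ord0] is reached only when [inord k] is the root, since every other vertex has a
   parent. *)
pose Q k := rank (odflt ord0 [pick i | parent E i (inord k)]).
have parQ j : j != ord0 -> parent E (up Q j) j.
  move=> j0; rewrite /up rankK inord_val; case: pickP => //= np.
  by have [i] := parent_exists j0; rewrite np.
have QE j : Q j = rank (up Q j) by rewrite /up rank_inord ?rank_gt0.
have eq_up i j : parent E i j -> i = up Q j.
  by move=> pij; have [_ /parQ] := parent_rank pij; apply: parent_uniq.
have nz k (k0 : 0 < k) (kn : k < n.+1) : Ordinal kn != ord0 by rewrite nz_gt0.
have gtQ k : 1 <= k < n.+1 -> k < Q k.
  case/andP=> k0 kn; have j0 := nz k k0 kn.
  have [+ _] := parent_rank (parQ _ j0).
  by rewrite -QE rank_nz.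
exists Q; first split=> //.
- move=> k _; rewrite /Q.
  by have := rank_gt0 (odflt ord0 [pick i | parent E i (inord k)]); lia.
(* If [k < l < Q k < Q l], the edges from [k] and [l] to their parents cross. When the parent of [l]
   is the root, it is the first of the four endpoints instead of the last. *)
- move=> k l k0 kl ln lQ; rewrite leqNgt; apply/negP => ltQ.
  have kn := ltn_trans kl ln.
  pose i := Ordinal kn; pose j := Ordinal ln.
  have i0 := nz k k0 kn; have j0 := nz l (ltn_trans k0 kl) ln.
  have Ei : adj E i (up Q i) by rewrite adj_sym; case/andP: (parQ i i0).
  have Ej : adj E j (up Q j) by rewrite adj_sym; case/andP: (parQ j j0).
  have Qi : Q k = rank (up Q i) := QE i.
  have Qj : Q l = rank (up Q j) := QE j.
  have Qi_lt : Q k < n.+1.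
    by have := rank_gt0 (up Q j); rewrite -Qj; lia.
  have ui0 : up Q i != ord0.
    by apply: contraTneq Qi_lt => eq0; rewrite Qi eq0 rank0 ltnn.
  rewrite rank_nz // in Qi.
  have nc (a b c d : 'I_n.+1) :
      a < b -> b < c -> c < d -> adj E a c -> adj E b d -> False.
    move=> ab bc cd Eac Ebd.
    have /'forall_'forall_'forall_'forall_implyP/(_ a b c d) := ncE.
    by rewrite ab bc cd Eac Ebd => /(_ isT).
  have [uj0|uj0] := eqVneq (up Q j) ord0.
    apply: (nc ord0 i j (up Q i)) => //=; first by lia.
    by rewrite -uj0 adj_sym.
  rewrite rank_nz // in Qj.
  by apply: (nc i j (up Q i) (up Q j)) => //=; lia.
apply/setP => e; apply/idP/imsetP => [eE|[j]]; last first.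
  by rewrite inE => /parQ/andP[/andP[_ +] _] ->; rewrite setUC.
have /'forall_implyP/(_ e eE)/cards2P[u [v [neq eq_e]]] := graphE.
have /adj_parent/orP[] : adj E u v by rewrite /adj /= neq -eq_e.
  move=> p; exists v; last by rewrite eq_e setUC (eq_up _ _ p).
  by rewrite inE; case: (parent_rank p).
move=> p; exists u; last by rewrite eq_e (eq_up _ _ p).
by rewrite inE; case: (parent_rank p).
Qed.

End ProperTree.

Lemma parent_graph_proper_even Q v : nested 1 n.+1 n.+1 Q ->
    proper_noncrossing_tree (parent_graph Q) -> v != ord0 ->
  ~~ odd (nchildren 1 n.+1 Q v).
Proof.
move=> nQ pE v0; rewrite -card_children // -left_children_child //.
by case: (proper_left pE v0).
Qed.

End ParentGraph.

(** * The bijection *)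

Definition tree_of_sym n (t : sym_ternary n) :=
  parent_graph n (par (forest_of_sym t) 1 n.+1).

Lemma fsize_sym n (t : sym_ternary n) : fsize (forest_of_sym t) = n.
Proof. by case/andP: (valP t) => st /eqP szt; rewrite fsize_forest_of_sym. Qed.

Lemma nested_sym n (t : sym_ternary n) :
  nested 1 n.+1 n.+1 (par (forest_of_sym t) 1 n.+1).
Proof.
by have := @par_nested (forest_of_sym t) 1 n.+1; rewrite fsize_sym; apply.
Qed.

Lemma tree_of_sym_proper n (t : sym_ternary n) :
  proper_noncrossing_tree (tree_of_sym t).
Proof.
apply: (parent_graph_proper (nested_sym t)) => v v0.
have [|+ _] := @even_forestP (forest_of_sym t) 1 n.+1; rewrite fsize_sym //.
by apply; [exact: even_forest_of_sym | rewrite -nz_gt0 v0 ltn_ord].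
Qed.

Lemma tree_of_sym_inj n : injective (@tree_of_sym n).
Proof.
move=> t t' /(parent_graph_inj (nested_sym t) (nested_sym t')) eqQ.
apply: val_inj.
case/andP: (valP t) (valP t') => st _ /andP[st' _].
apply: forest_of_sym_inj => //.
by apply: (@par_inj _ _ 1 n.+1); rewrite ?fsize_sym.
Qed.

Lemma tree_of_sym_surj n (E : {set {set 'I_n.+1}}) :
  proper_noncrossing_tree E -> exists t : sym_ternary n, tree_of_sym t = E.
Proof.
move=> pE; have [Q nQ eqE] := proper_parent_graph pE.
have [||F szF eqQ] := nested_par _ _ nQ => //.
have evF : even_forest F.
  apply/(@even_forestP F 1 n.+1); rewrite szF // => w /andP[w0 wn].
  rewrite (eq_nchildren _ eqQ).
  have := @parent_graph_proper_even n Q (Ordinal wn) nQ.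
  by rewrite -eqE nz_gt0; apply.
have [t st eqF] := forest_of_sym_surj evF.
have ht : symmetric_ternary t && (internal t == n).
  by rewrite st -fsize_forest_of_sym // eqF -eqSS -add1n szF /=.
exists (SymTernary ht); rewrite /tree_of_sym /= eqF eqE.
apply: eq_in_imset => j; rewrite inE nz_gt0 => j0.
by rewrite /up eqQ // j0 ltn_ord.
Qed.

Theorem theorem2p1 (n : nat) :
  (exists f : proper_nct n -> sym_ternary n, bijective f) /\
  #|{: proper_nct n}| = #|{: sym_ternary n}|.
Proof.
pose g (t : sym_ternary n) : proper_nct n :=
  Sub (tree_of_sym t) (tree_of_sym_proper t).
have g_inj : injective g by move=> t t' /(congr1 val)/tree_of_sym_inj.
have g_surj E : exists t, g t == E.
  have [t eqE] := tree_of_sym_surj (valP E).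
  by exists t; apply/eqP/val_inj.
pose f E := xchoose (g_surj E).
have fK : cancel f g by move=> E; apply/eqP/(xchooseP (g_surj E)).
have f_bij : bijective f by exists g => // t; apply: g_inj; rewrite fK.
by split; [exists f | apply: bij_eq_card f_bij].
Qed.
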